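(* Let $\mathcal{G}_1$ and $\mathcal{G}_2$ be two non-cospectral equienergetic graphs of order $n$ with $\chi_{\mathcal{A}_{\mathcal{G}_1}}(x)=\chi_{\mathcal{A}_{\mathcal{G}_2}}(x)$. Then for an arbitrary graph $\mathcal{G}$ of order $m$, the graphs $\mathcal{G}\boxtimes\mathcal{G}_1$ and $\mathcal{G}\boxtimes\mathcal{G}_2$ are non-cospectral and equienergetic.
   Context: All graphs are finite, simple and undirected. For graphs $\mathcal{H}_1$ (vertices $u_1,\ldots,u_p$) and $\mathcal{H}_2$, the closed neighborhood corona $\mathcal{H}_1\boxtimes\mathcal{H}_2$ is obtained from $\mathcal{H}_1$ and $p$ disjoint copies of $\mathcal{H}_2$ by joining every vertex of the $i$-th copy to $u_i$ and to every neighbor of $u_i$ in $\mathcal{H}_1$, for each $i$. For a square matrix $M$ of order $n$, $\chi_M(x)=\mathbf{1}_n^T(xI_n-M)^{-1}\mathbf{1}_n$ (a rational function) with $\mathbf{1}_n$ the all-ones vector; $\mathcal{A}_{\mathcal{G}}$ is the adjacency matrix. The energy of a graph is the sum of the absolute values of its adjacency eigenvalues; two graphs are equienergetic if they have the same number of vertices and the same energy, and cospectral if their adjacency matrices have the same characteristic polynomial. *)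

(* Defs.v *)
From HB Require Import structures.
From mathcomp Require Import all_boot all_order all_algebra all_field.
Set Implicit Arguments. Unset Strict Implicit. Unset Printing Implicit Defensive.
Import GRing.Theory Num.Theory.
Local Open Scope ring_scope.

Record sgraph := SGraph {
  vertex :> finType;
  adj : rel vertex;
  adj_sym : symmetric adj;
  adj_irr : irreflexive adj
}.

Definition gorder (G : sgraph) : nat := #|vertex G|.

Definition coronaV (H1 H2 : sgraph) : finType := (H1 + H1 * H2)%type.

(* [inr (i, w)] is the vertex [w] of the copy of [H2] attached to [i : H1]. *)
Definition corona_adj (H1 H2 : sgraph) (x y : coronaV H1 H2) : bool :=
  match x, y with
  | inl u, inl v => adj u v
  | inl u, inr (i, _) => (u == i) || adj i u
  | inr (i, _), inl u => (u == i) || adj i u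
  | inr (i, w), inr (j, z) => (i == j) && adj w z
  end.

Lemma corona_sym (H1 H2 : sgraph) : symmetric (@corona_adj H1 H2).
Proof.
by move=> [u|[i w]] [v|[j z]] //=; [exact: adj_sym | rewrite eq_sym adj_sym].
Qed.

Lemma corona_irr (H1 H2 : sgraph) : irreflexive (@corona_adj H1 H2).
Proof. by move=> [u|[i w]] /=; rewrite adj_irr ?andbF. Qed.

Definition closed_nbhd_corona (H1 H2 : sgraph) : sgraph :=
  SGraph (@corona_sym H1 H2) (@corona_irr H1 H2).

(* Adjacency eigenvalues are real algebraic numbers, so matrices are taken over
   [algC], where every characteristic polynomial splits. *)
Definition adjmx (G : sgraph) : 'M[algC]_(gorder G) :=
  \matrix_(i, j) (adj (enum_val i : G) (enum_val j))%:R.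

(* Eigenvalues with algebraic multiplicity; see [eigenvaluesP]. *)
Definition eigenvalues (n : nat) (M : 'M[algC]_n) : seq algC :=
  sval (closed_field_poly_normal (char_poly M)).

Lemma eigenvaluesP (n : nat) (M : 'M[algC]_n) :
  char_poly M = \prod_(z <- eigenvalues M) ('X - z%:P).
Proof.
rewrite /eigenvalues; case: closed_field_poly_normal => s /= {1}->.
by rewrite (monicP (char_poly_monic M)) scale1r.
Qed.

Definition energy (G : sgraph) : algC := \sum_(z <- eigenvalues (adjmx G)) `|z|.

Definition equienergetic (G H : sgraph) : Prop :=
  gorder G = gorder H /\ energy G = energy H.

Definition cospectral (G H : sgraph) : Prop :=
  char_poly (adjmx G) = char_poly (adjmx H).

(* The matrix x I_n - M over the field of rational functions in x. *)
Definition xIsub (F : fieldType) (n : nat) (M : 'M[F]_n) :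
    'M[{fraction {poly F}}]_n :=
  map_mx (@tofrac {poly F}) (char_poly_mx M).

Lemma xIsub_unit (F : fieldType) (n : nat) (M : 'M[F]_n) :
  xIsub M \in unitmx.
Proof.
rewrite unitmxE /xIsub det_map_mx unitfE tofrac_eq0.
exact: monic_neq0 (char_poly_monic M).
Qed.

Definition ones (K : fieldType) (n : nat) : 'cV[K]_n := const_mx 1.

Definition chi (F : fieldType) (n : nat) (M : 'M[F]_n) : {fraction {poly F}} :=
  ((ones _ n)^T *m invmx (xIsub M) *m ones _ n) 0 0.

(* Main.v *)
(** Over the field of rational functions, the Schur complement of the block
    formed by the copies of [H] gives
      char_poly (G corona H)
        = char_poly H ^ #|G| * det (x - A - chi_H (A + 1) ^ 2)
    with [A] the adjacency matrix of [G]. The last factor depends on [H] only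
    through [chi_H], so equal [chi] forces
      char_poly (G corona G1) * char_poly G2 ^ m
        = char_poly (G corona G2) * char_poly G1 ^ m.
    Comparing root multisets in this identity yields both conclusions. *)
Require Import Defs.
From mathcomp Require Import all_boot all_order all_fingroup all_algebra.
From mathcomp Require Import all_field.

Set Implicit Arguments.
Unset Strict Implicit.
Unset Printing Implicit Defensive.
Import GRing.Theory.
Local Open Scope ring_scope.

Section Determinants.

Variable R : comNzRingType.

Lemma det_castmx (n n' : nat) (e1 e2 : n = n') (A : 'M[R]_n) :
  \det (castmx (e1, e2) A) = \det A.
Proof. by case: _ / e1 in e2 *; rewrite castmx_id. Qed.

Lemma det_mxdiag (m : nat) (p : 'I_m -> nat) (B : forall i, 'M[R]_(p i)) :
  \det (\mxdiag_i B i) = \prod_i \det (B i).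
Proof.
elim: m p B => [|m IHm] p B.
  rewrite [RHS]big_ord0; move: (mxdiag _); rewrite big_ord0 => A.
  exact: det_mx00.
by rewrite mxdiag_recl det_castmx det_ublock IHm big_ord_recl.
Qed.

(** Changing the enumeration permutes rows and columns by the same permutation, so the two signs
    cancel. *)
Lemma det_reindex (T : finType) (n : nat) (g : 'I_n -> T) (f : T -> T -> R) :
  bijective g ->
  \det (\matrix_(i < #|T|, j < #|T|) f (enum_val i) (enum_val j)) =
  \det (\matrix_(i < n, j < n) f (g i) (g j)).
Proof.
move=> bij_g; have eqn : n = #|T|.
  by rewrite -(bij_eq_card bij_g) card_ord.
subst n.
have s_inj : injective (fun i => enum_rank (g i)).
  by move=> i j /enum_rank_inj/(bij_inj bij_g).
pose s := perm s_inj.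
set A := \matrix_(i, j) _.
have -> : \matrix_(i, j) f (g i) (g j) = row_perm s (col_perm s A).
  by apply/matrixP => i j; rewrite !mxE !permE !enum_rankK.
rewrite row_permE col_permE !det_mulmx !det_perm mulrCA -signr_addb.
by rewrite odd_permV addbb mulr1.
Qed.

(** Right multiplication by a unipotent block lower triangular matrix clears the block [L]. *)
Lemma det_schur (n1 n2 : nat) (P : 'M[R]_n1)
    (Q : 'M[R]_(n1, n2)) (L : 'M[R]_(n2, n1)) (S S' : 'M[R]_n2) :
  S *m S' = 1%:M ->
  \det (block_mx P Q L S) = \det (P - Q *m S' *m L) * \det S.
Proof.
move=> SS'; rewrite -(det_ublock _ Q).
have <- : block_mx P Q L S *m block_mx 1%:M 0 (- (S' *m L)) 1%:M =
          block_mx (P - Q *m S' *m L) Q 0 S.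
  rewrite mulmx_block !mulmx1 !mulmx0 !add0r !mulmxN !mulmxA SS' mul1mx.
  by rewrite subrr.
by rewrite det_mulmx det_lblock !det1 !mulr1.
Qed.

End Determinants.

Section Corona.

Variables G H : sgraph.
Local Notation m := (gorder G).
Local Notation n := (gorder H).

(** Lists [G] first, then the copies of [H] one after another. The size is kept as a sum because
    [\mxdiag], [\mxrow] and [\mxcol] index their blocks that way. *)
Definition corona_index (k : 'I_(m + \sum_(i < m) n)) : coronaV G H :=
  match split k with
  | inl i => inl (enum_val i)
  | inr s => inr (enum_val (tagnat.sig1 s), enum_val (tagnat.sig2 s))
  end.

Lemma gorder_corona : gorder (closed_nbhd_corona G H) = (m + m * n)%N.
Proof. by rewrite /gorder /= card_sum card_prod. Qed.

Lemma corona_index_bij : bijective corona_index.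
Proof.
apply: inj_card_bij; last first.
  by rewrite card_ord sum_nat_const card_ord -gorder_corona.
move=> k l; rewrite /corona_index => eq_kl.
rewrite -[k]splitK -[l]splitK; move: eq_kl.
case: (split k) (split l) => [i|s] [j|t] //= [].
  by move/enum_val_inj->.
move/enum_val_inj => e1 /enum_val_inj e2.
congr rshift; rewrite -(tagnat.sig2K s) -(tagnat.sig2K t).
by move: (tagnat.sig2 s) (tagnat.sig2 t) e2; rewrite e1 => a b ->.
Qed.

Local Notation K := {fraction {poly algC}}.

Definition closed_nbhd_mx : 'M[K]_m :=
  map_mx (fun z => tofrac z%:P) (adjmx G + 1%:M).
Local Notation N := closed_nbhd_mx.

Lemma closed_nbhd_mxE (i j : 'I_m) :
  N i j = tofrac (((enum_val i == enum_val j :> G)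
                  || adj (enum_val i : G) (enum_val j))%:R)%:P.
Proof.
rewrite !mxE (inj_eq enum_val_inj) -natrD; congr (tofrac (_%:R)%:P).
(* By irreflexivity the two truth values are never both 1, so their sum is that of the
   disjunction. *)
by case: eqVneq => [->|_]; rewrite ?adj_irr ?addn0.
Qed.

Lemma char_poly_corona :
  tofrac (char_poly (adjmx (closed_nbhd_corona G H))) =
  \det (xIsub (adjmx G) - chi (adjmx H) *: (N *m N))
  * tofrac (char_poly (adjmx H)) ^+ m.
Proof.
pose f (x y : coronaV G H) : K :=
  tofrac ('X *+ (x == y) - ((corona_adj x y)%:R)%:P).
have -> : tofrac (char_poly (adjmx (closed_nbhd_corona G H))) =
  \det (\matrix_(i < #|coronaV G H|, j < #|coronaV G H|)
          f (enum_val i) (enum_val j)).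
  rewrite /char_poly -det_map_mx; congr (\det _); apply/matrixP => i j.
  by rewrite !mxE /f (inj_eq enum_val_inj).
rewrite (det_reindex _ corona_index_bij).
(* All vertices of copy [i] have the same neighbors in [G], so the off-diagonal blocks have rank
   one. *)
pose Q : 'M[K]_(m, \sum_(i < m) n) := \mxrow_(i < m) (col i N *m (ones _ n)^T).
pose L : 'M[K]_(\sum_(i < m) n, m) := \mxcol_(i < m) (ones _ n *m row i N).
pose S : 'M[K]_(\sum_(i < m) n) := \mxdiag_(i < m) xIsub (adjmx H).
pose S' : 'M[K]_(\sum_(i < m) n) := \mxdiag_(i < m) invmx (xIsub (adjmx H)).
have -> : \matrix_(i, j) f (corona_index i) (corona_index j) =
          block_mx (xIsub (adjmx G)) (- Q) (- L) S.
  apply/matrixP => i j; rewrite mxE /corona_index.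
  rewrite -[i in RHS]splitK -[j in RHS]splitK.
  case: (split i) (split j) => [{}i|s] [{}j|t] /=.
  - by rewrite block_mxEul !mxE /f /= (inj_eq inl_inj) (inj_eq enum_val_inj).
  - rewrite block_mxEur 3!mxE big_ord1 [col _ _ _ _]mxE [_^T _ _]mxE.
    rewrite [ones _ _ _ _]mxE mulr1.
    by rewrite closed_nbhd_mxE /f /= sub0r rmorphN /= adj_sym.
  - rewrite block_mxEdl 3!mxE big_ord1 [row _ _ _ _]mxE [ones _ _ _ _]mxE mul1r.
    by rewrite closed_nbhd_mxE /f /= sub0r rmorphN /= eq_sym.
  - rewrite block_mxEdr mxE /f /= (inj_eq inr_inj) xpair_eqE.
    rewrite !(inj_eq enum_val_inj).
    case: eqVneq => _ /=; last by rewrite mxE subr0 rmorph0.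
    by rewrite conform_mx_id !mxE.
have SS' : S *m S' = 1%:M.
  etransitivity; first exact: mul_mxdiag_mxblock.
  rewrite -[RHS]mxdiagZ; apply: eq_mxblock => i j.
  case: eqVneq => [_|]; last by rewrite mulmx0.
  by rewrite !conform_mx_id mulmxV ?xIsub_unit.
rewrite (det_schur _ _ _ SS') det_mxdiag prodr_const card_ord /xIsub det_map_mx.
congr (\det (_ - _) * _).
rewrite mulNmx mulNmx mulmxN opprK mul_mxrow_mxdiag mul_mxrow_mxcol.
(* Copy [i] contributes the scalar [chi] times column [i] of [N] times row [i] of [N]; these
   rank-one products add up to [N *m N]. *)
have chi_mx : (ones K n)^T *m invmx (xIsub (adjmx H)) *m ones K n =
              (chi (adjmx H))%:M by apply: mx11_scalar.
under eq_bigr => i _ do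
  rewrite mulmxA -!(mulmxA (col i N)) chi_mx mul_scalar_mx -scalemxAr.
rewrite -scaler_sumr; congr (_ *: _).
apply/matrixP => i j; rewrite summxE !mxE; apply: eq_bigr => k _.
by rewrite mxE big_ord1 !mxE.
Qed.

End Corona.

Lemma char_poly_corona_cross (G G1 G2 : sgraph) :
  chi (adjmx G1) = chi (adjmx G2) ->
  char_poly (adjmx (closed_nbhd_corona G G1)) *
    char_poly (adjmx G2) ^+ gorder G =
  char_poly (adjmx (closed_nbhd_corona G G2)) *
    char_poly (adjmx G1) ^+ gorder G.
Proof.
(* [tofrac] is injective, so the identity is checked among fractions, where [chiE] identifies the
   two Schur determinants. *)
move=> chiE; apply/eqP; rewrite -tofrac_eq; apply/eqP.
rewrite !rmorphM !rmorphXn /= !char_poly_corona chiE.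
by rewrite -!mulrA [X in _ * X]mulrC.
Qed.

Lemma prod_XsubC_expr (F : fieldType) (s : seq F) (m : nat) :
  (\prod_(z <- s) ('X - z%:P)) ^+ m =
  \prod_(z <- flatten (nseq m s)) ('X - z%:P).
Proof. by rewrite big_flatten big_nseq iter_mulr_1. Qed.

(** The power multiplies every root multiplicity by [m], a positive factor that cancels. *)
Lemma prod_XsubC_expr_inj (F : fieldType) (s t : seq F) (m : nat) : (0 < m)%N ->
  (\prod_(z <- s) ('X - z%:P)) ^+ m = (\prod_(z <- t) ('X - z%:P)) ^+ m ->
  \prod_(z <- s) ('X - z%:P) = \prod_(z <- t) ('X - z%:P).
Proof.
move=> m_gt0; rewrite !prod_XsubC_expr => /prod_XsubC_eq/seq.permP st.
apply/perm_big/seq.permP => a; move: (st a).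
rewrite !count_flatten !map_nseq !sumn_nseq => /eqP.
by rewrite eqn_pmul2r // => /eqP.
Qed.

(** Both sides of the crossed identity have the same root multiset; summing absolute values over it
    turns products into sums and powers into multiples. *)
Lemma energy_corona_cross (G G1 G2 : sgraph) :
  chi (adjmx G1) = chi (adjmx G2) ->
  energy (closed_nbhd_corona G G1) + energy G2 *+ gorder G =
  energy (closed_nbhd_corona G G2) + energy G1 *+ gorder G.
Proof.
move=> /(char_poly_corona_cross G); rewrite !eigenvaluesP !prod_XsubC_expr.
rewrite -!big_cat => /prod_XsubC_eq eq_roots.
have sum_flatten (k : nat) (s : seq algC) :
    \sum_(z <- flatten (nseq k s)) `|z| = (\sum_(z <- s) `|z|) *+ k.
  by rewrite big_flatten big_nseq iter_addr_0.
by rewrite /energy -!sum_flatten -!big_cat; apply: perm_big.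
Qed.

Local Close Scope ring_scope.

Theorem theorem6 (m n : nat) (G G1 G2 : sgraph)
    (m_gt0 : 0 < m) (oG : gorder G = m)
    (oG1 : gorder G1 = n) (oG2 : gorder G2 = n)
    (ncosp : ~ cospectral G1 G2)
    (eqen : equienergetic G1 G2)
    (chiE : chi (adjmx G1) = chi (adjmx G2)) :
  ~ cospectral (closed_nbhd_corona G G1) (closed_nbhd_corona G G2)
  /\ equienergetic (closed_nbhd_corona G G1) (closed_nbhd_corona G G2).
Proof.
case: eqen => _ eqE; split=> [cosp|].
  apply: ncosp; move: (char_poly_corona_cross G chiE); rewrite cosp.
  (* The common characteristic polynomial of the coronas is monic, hence cancels, leaving equal
     [m]-th powers for [G1] and [G2]. *)
  move/(mulfI (monic_neq0 (char_poly_monic _))).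
  rewrite /cospectral oG !eigenvaluesP => /esym.
  exact: prod_XsubC_expr_inj.
split; first by rewrite !gorder_corona oG1 oG2.
by move: (energy_corona_cross G chiE); rewrite eqE => /addIr.
Qed.
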